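(* Consider the proximal method of multipliers (PMM) with parameters $\alpha>0$ and $\epsilon>0$, whose primal and dual iterates $x_t,v_t\in\mathbb{R}^{np}$ are given by $$x_{t+1}=\operatorname*{argmin}_{x\in\mathbb{R}^{np}}\Big\{\mathcal{L}(x,v_t)+\frac{\epsilon}{2}\|x-x_t\|^2\Big\},\qquad v_{t+1}=v_t+\alpha (I-Z)^{1/2}x_{t+1}.$$ Let $\beta>1$ be an arbitrary constant strictly larger than $1$, and let $\hat\lambda_{\min}(I-Z)$ denote the smallest non-zero eigenvalue of $I-Z$. Suppose that the local functions $f_i$ are twice differentiable and that there are constants $0<m\le M<\infty$ with $mI\preceq\nabla^2 f_i(y)\preceq MI$ for all $y\in\mathbb{R}^p$ and all $i=1,\dots,n$. Then the sequence $\|u_t-u^*\|_G^2$ generated by PMM satisfies $$\|u_{t+1}-u^*\|_G^2\ \le\ \frac{1}{1+\delta}\,\|u_t-u^*\|_G^2,$$ where $$\delta=\min\left\{\frac{2\alpha\hat\lambda_{\min}(I-Z)}{\beta(m+M)},\ \frac{2mM}{\epsilon(m+M)},\ \frac{(\beta-1)\alpha\hat\lambda_{\min}(I-Z)}{\beta\epsilon}\right\}.$$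
   Context: Setting. A bidirectionally connected network has $n$ nodes; $\mathcal{N}_i$ denotes the set of neighbors of node $i$. Node $i$ has a local objective function $f_i:\mathbb{R}^p\to\mathbb{R}$. For $x=[x_1;\dots;x_n]\in\mathbb{R}^{np}$ with $x_i\in\mathbb{R}^p$, put $f(x)=\sum_{i=1}^n f_i(x_i)$. The weight matrix $W\in\mathbb{R}^{n\times n}$ has entries $w_{ij}\ge 0$, with $w_{ij}=0$ if and only if $j\notin\mathcal{N}_i\cup\{i\}$, and satisfies $W^T=W$, $W\mathbf{1}=\mathbf{1}$, $\mathrm{null}(I-W)=\mathrm{span}(\mathbf{1})$, where $\mathbf{1}$ is the all-ones vector. Put $Z:=W\otimes I_p\in\mathbb{R}^{np\times np}$ (Kronecker product with the $p\times p$ identity); $I-Z$ is positive semidefinite and $(I-Z)^{1/2}$ is its positive semidefinite square root. The augmented Lagrangian is $\mathcal{L}(x,v)=f(x)+v^T(I-Z)^{1/2}x+\frac{\alpha}{2}x^T(I-Z)x$ for $x,v\in\mathbb{R}^{np}$, with the same $\alpha>0$ as in the dual update. Optimal arguments. $x^*$ is the solution of $\min_{x\in\mathbb{R}^{np}} f(x)$ subject to $(I-Z)^{1/2}x=0$, and $v^*$ is the optimal dual variable of this problem, satisfying the KKT condition $\nabla f(x^* )+(I-Z)^{1/2}v^*=0$. Notation. $u_t=[v_t;x_t]\in\mathbb{R}^{2np}$, $u^*=[v^*;x^*]\in\mathbb{R}^{2np}$, $G=\begin{bmatrix} I&0\\0&\alpha\epsilon I\end{bmatrix}\in\mathbb{R}^{2np\times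 2np}$, $\|u\|_G^2=u^TGu$; thus $\|u_t-u^*\|_G^2=\|v_t-v^*\|^2+\alpha\epsilon\|x_t-x^*\|^2$. $\|\cdot\|$ is the Euclidean norm.
   Formalization: The optimal dual variable v* is unique only modulo the kernel of (I-Z)^{1/2}; here v* is taken to be the one with v_0 - v* in the range of (I-Z)^{1/2}, without which the contraction fails. *)

(* Defs.v *)
From mathcomp Require Import all_boot all_order all_algebra.
From mathcomp Require Export mxtens.
From mathcomp Require Import all_classical all_reals all_analysis.

Set Implicit Arguments.
Unset Strict Implicit.
Unset Printing Implicit Defensive.

Import Order.TTheory GRing.Theory Num.Theory.
Import numFieldNormedType.Exports.
Local Open Scope ring_scope.

Section LinearAlgebra.
Variable R : realType.

Definition dotp (d : nat) (u w : 'cV[R]_d) : R := (u^T *m w) 0 0.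

(* [qform 1%:M] is the squared Euclidean norm. The library's
   norm on matrices is the sup norm, so it is not used here. *)
Definition qform (d : nat) (A : 'M[R]_d) (u : 'cV[R]_d) : R :=
  (u^T *m A *m u) 0 0.

Definition psd (d : nat) (A : 'M[R]_d) : Prop :=
  A^T = A /\ forall u : 'cV[R]_d, 0 <= qform A u.

Definition loewner_le (d : nat) (A B : 'M[R]_d) : Prop := psd (B - A).

Definition is_psd_sqrt (d : nat) (S A : 'M[R]_d) : Prop :=
  psd S /\ S *m S = A.

Definition is_min_nonzero_eigenvalue (d : nat) (A : 'M[R]_d) (a : R) : Prop :=
  [/\ eigenvalue A a, a != 0 &
      forall b : R, eigenvalue A b -> b != 0 -> a <= b].

End LinearAlgebra.

Section Calculus.
Variable R : realType.

Definition grad (d : nat) (g : 'cV[R]_d -> R) (y : 'cV[R]_d) : 'cV[R]_d :=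
  \col_i 'D_(delta_mx i 0) g y.

Definition hess (d : nat) (g : 'cV[R]_d -> R) (y : 'cV[R]_d) : 'M[R]_d :=
  \matrix_(i, j) 'D_(delta_mx j 0) (fun z => grad g z i 0) y.

(* Frechet differentiability of g and of its gradient at every point. *)
Definition twice_differentiable (d : nat) (g : 'cV[R]_d -> R) : Prop :=
  (forall y, differentiable g y) /\ (forall y, differentiable (grad g) y).

End Calculus.

Section Network.
Variables (R : realType) (n p : nat).

Definition connected_network (N : 'I_n -> {set 'I_n}) : Prop :=
  [/\ forall i, i \notin N i,
      forall i j, (j \in N i) = (i \in N j) &
      forall i j, connect (fun k l => l \in N k) i j].

Definition weight_matrix (N : 'I_n -> {set 'I_n}) (W : 'M[R]_n) : Prop :=
  [/\ forall i j, 0 <= W i j,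
      forall i j, W i j = 0 <-> j \notin i |: N i,
      W^T = W,
      W *m const_mx 1 = const_mx 1 :> 'cV[R]_n &
      forall y : 'cV[R]_n,
        (1%:M - W) *m y = 0 <-> exists c : R, y = c *: const_mx 1].

(* [tensmx] orders indices as [mxtens_index (i, k) = i * p + k], so the i-th
   block of p consecutive coordinates of x is the copy held by node i. *)
Definition block (x : 'cV[R]_(n * p)) (i : 'I_n) : 'cV[R]_p :=
  \col_k x (mxtens_index (i, k)) 0.

Definition aggregate (f : 'I_n -> 'cV[R]_p -> R) (x : 'cV[R]_(n * p)) : R :=
  \sum_(i < n) f i (block x i).

Definition kron_weight (W : 'M[R]_n) : 'M[R]_(n * p) :=
  tensmx W (1%:M : 'M[R]_p).

End Network.

Section PMM.
Variables (R : realType) (d : nat).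
(* F is the objective, S the square root of the constraint matrix A. *)
Variables (F : 'cV[R]_d -> R) (S A : 'M[R]_d).

Definition is_minimizer (P : 'cV[R]_d -> Prop) (phi : 'cV[R]_d -> R)
    (x : 'cV[R]_d) : Prop :=
  P x /\ forall y, P y -> phi x <= phi y.

Definition primal_solution (x : 'cV[R]_d) : Prop :=
  is_minimizer (fun y => S *m y = 0) F x.

Definition kkt_multiplier (x v : 'cV[R]_d) : Prop :=
  grad F x + S *m v = 0.

Definition aug_lagrangian (alpha : R) (x v : 'cV[R]_d) : R :=
  F x + dotp v (S *m x) + alpha / 2 * qform A x.

Definition pmm_iterates (alpha eps : R) (x v : nat -> 'cV[R]_d) : Prop :=
  forall t : nat,
    is_minimizer (fun=> True)
      (fun y => aug_lagrangian alpha y (v t)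
                + eps / 2 * qform 1%:M (y - x t))
      (x t.+1)
    /\ v t.+1 = v t + alpha *: (S *m x t.+1).

End PMM.

Definition Gmx (R : realType) (d : nat) (alpha eps : R) : 'M[R]_(d + d) :=
  block_mx 1%:M 0 0 (alpha * eps)%:M.

(* Main.v *)
(* With [dx = x_{t+1} - x*], [dv = v_{t+1} - v*], [sx = x_{t+1} - x_t] and
   [g] the difference of the gradients at [x_{t+1}] and [x*], the optimality
   condition of the proximal step and the dual update give
   [g + eps sx = - S dv] and [v_{t+1} - v_t = alpha S dx].  Pairing the first
   with [dx] expresses the decrease of the G-norm as [2 alpha <g, dx>] plus
   squares of the steps.  Cocoercivity bounds [<g, dx>] below by [|g|^2] and
   [|dx|^2], while [dv] lies in the range of [S], so that
   [lam_min |dv|^2 <= |S dv|^2 = |g + eps sx|^2], which Young's inequality splits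
   with the parameter [beta].
   Since the Hessian need not be continuous, cocoercivity is not obtained by
   integration: for [P = g - (m + M)/2 dx] it says [|P| <= (M - m)/2 |dx|], which
   follows from the scalar mean value theorem for the gradient paired with [P].
   The spectral gap comes from the spectral theorem over [R[i]]. *)
Require Import Defs.
From mathcomp Require Import all_boot all_order all_algebra.
From mathcomp Require Import all_classical all_reals all_analysis.
From mathcomp Require Import complex ring lra.

Set Implicit Arguments.
Unset Strict Implicit.
Unset Printing Implicit Defensive.

Import Order.TTheory GRing.Theory Num.Theory.
Import numFieldNormedType.Exports.
Local Open Scope ring_scope.

(** * Euclidean inner product and Young's inequality *)

Section DotProduct.
Variables (R : realType) (d : nat).
Implicit Types (u v w : 'cV[R]_d) (A B : 'M[R]_d) (a : R).

Lemma dotpE u v : dotp u v = \sum_i u i 0 * v i 0.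
Proof. by rewrite /dotp mxE; apply: eq_bigr => i _; rewrite mxE. Qed.

Lemma dotpC u v : dotp u v = dotp v u.
Proof. by rewrite !dotpE; apply: eq_bigr => i _; rewrite mulrC. Qed.

Lemma dotpDr u v w : dotp u (v + w) = dotp u v + dotp u w.
Proof. by rewrite /dotp mulmxDr mxE. Qed.

Lemma dotpZr a u v : dotp u (a *: v) = a * dotp u v.
Proof. by rewrite /dotp -scalemxAr mxE. Qed.

Lemma dotpNr u v : dotp u (- v) = - dotp u v.
Proof. by rewrite /dotp mulmxN mxE. Qed.

Lemma dotpBr u v w : dotp u (v - w) = dotp u v - dotp u w.
Proof. by rewrite dotpDr dotpNr. Qed.

Lemma dotpDl u v w : dotp (u + v) w = dotp u w + dotp v w.
Proof. by rewrite dotpC dotpDr !(dotpC w). Qed.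

Lemma dotpZl a u v : dotp (a *: u) v = a * dotp u v.
Proof. by rewrite dotpC dotpZr dotpC. Qed.

Lemma dotpBl u v w : dotp (u - v) w = dotp u w - dotp v w.
Proof. by rewrite dotpC dotpBr !(dotpC w). Qed.

Lemma dotp_ge0 u : 0 <= dotp u u.
Proof. by rewrite dotpE sumr_ge0 // => i _; rewrite -expr2 sqr_ge0. Qed.

Lemma dotp_eq0 u : dotp u u <= 0 -> u = 0.
Proof.
move=> u0; have /eqP: dotp u u = 0 by apply/le_anti; rewrite u0 dotp_ge0.
rewrite dotpE psumr_eq0; last by move=> i _; rewrite -expr2 sqr_ge0.
move=> /allP/= h; apply/colP => i; rewrite mxE.
by have := h i (mem_index_enum i); rewrite -expr2 sqrf_eq0 => /eqP.
Qed.

Lemma dotp_mulmx_sym A u v : A^T = A -> dotp (A *m u) v = dotp u (A *m v).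
Proof. by move=> symA; rewrite /dotp trmx_mul symA mulmxA. Qed.

Lemma qformE A u : qform A u = dotp u (A *m u).
Proof. by rewrite /qform /dotp mulmxA. Qed.

Lemma dotp_delta u i : dotp u (delta_mx i 0) = u i 0.
Proof.
rewrite dotpE (bigD1 i) //= big1 ?addr0 => [|j ji]; rewrite mxE ?eqxx ?mulr1 //.
by rewrite (negPf ji) mulr0.
Qed.

Lemma dotpDsq u v : dotp (u + v) (u + v) = dotp u u + 2 * dotp u v + dotp v v.
Proof. by rewrite !(dotpDl, dotpDr) (dotpC v u); ring. Qed.

Lemma dotpBsq u v : dotp (u - v) (u - v) = dotp u u - 2 * dotp u v + dotp v v.
Proof. by rewrite !(dotpBl, dotpBr) (dotpC v u); ring. Qed.

(* Young's inequality: the difference of the two sides is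
   [(a - 1) * |u - v / (a - 1)|^2]. *)
Lemma dotpD_young a u v : 1 < a ->
  dotp (u + v) (u + v) <= a * dotp u u + a / (a - 1) * dotp v v.
Proof.
move=> a1; have a10 : a - 1 != 0 by rewrite subr_eq0 gt_eqF.
have h : 0 <= (a - 1) * dotp (u - (a - 1)^-1 *: v) (u - (a - 1)^-1 *: v).
  by rewrite mulr_ge0 ?dotp_ge0 // subr_ge0 ltW.
rewrite -subr_ge0; apply: le_trans h _.
rewrite dotpBsq dotpDsq !(dotpZl, dotpZr) le_eqVlt; apply/orP; left.
by apply/eqP; field.
Qed.

End DotProduct.

(** * Symmetric matrices bounded in the Loewner order *)

Section SymmetricBounds.
Variables (R : realType) (d : nat).
Implicit Types (u v : 'cV[R]_d) (B : 'M[R]_d).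

(* Polarization: [4 u^T B v = (u + v)^T B (u + v) - (u - v)^T B (u - v)]. *)
Lemma dotp_mulmx_le B r u v : B^T = B ->
    (forall z, `|dotp z (B *m z)| <= r * dotp z z) ->
  2 * dotp u (B *m v) <= r * (dotp u u + dotp v v).
Proof.
move=> symB hB.
have := hB (u + v); have := hB (u - v); rewrite !ler_norml => /andP[h1 _] /andP[_ h2].
move: h1 h2; rewrite dotpBsq dotpDsq mulmxBr mulmxDr.
rewrite !(dotpBl, dotpBr, dotpDl, dotpDr).
rewrite -(dotp_mulmx_sym v u symB) (dotpC _ u) => h1 h2; lra.
Qed.

(** Subtracting the midpoint of [[m, M]] makes the two bounds symmetric about zero, the form that
    polarization uses. *)
Lemma loewner_centered (m M : R) B u :
  loewner_le m%:M B -> loewner_le B M%:M ->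
  `|dotp u ((B - ((m + M) / 2)%:M) *m u)| <= (M - m) / 2 * dotp u u.
Proof.
move=> [_ /(_ u)] + [_ /(_ u)]; rewrite !qformE !mulmxBl !mul_scalar_mx !dotpBr !dotpZr.
by move=> h1 h2; rewrite ler_norml; apply/andP; split; lra.
Qed.

End SymmetricBounds.

(** * Hessian, mean value theorem and cocoercivity *)

Section Gradient.
Variables (R : realType) (d : nat).
Implicit Types (g : 'cV[R]_d -> R) (y z v w : 'cV[R]_d).

(** Frechet differentiability makes the directional derivative linear in [v], so its values on the
    standard basis determine it. *)
Lemma hess_mulmxE g y v i : differentiable (grad g) y ->
  'D_v (fun z => grad g z i 0) y = (hess g y *m v) i 0.
Proof.
move=> dg; have dgi : differentiable (fun z => grad g z i 0) y.
  exact: (differentiable_comp dg (differentiable_coord _ i 0)).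
have -> : v = \sum_j v j 0 *: delta_mx j 0.
  rewrite {1}(matrix_sum_delta v); apply: eq_bigr => j _.
  by rewrite big_ord_recl big_ord0 addr0 (ord1 ord0).
rewrite deriveE // linear_sum mxE; apply: eq_bigr => j _.
rewrite linearZ /= -deriveE // !mxE summxE (bigD1 j) //= big1; last first.
  by move=> k kj; rewrite !mxE [j == k]eq_sym (negPf kj) mulr0.
by rewrite !mxE !eqxx mulr1 addr0 mulrC.
Qed.

Lemma is_derive_line g y v (s : R) : derivable g (s *: v + y) v ->
  is_derive s (1 : R) (fun t : R => g (t *: v + y)) ('D_v g (s *: v + y)).
Proof.
move=> dg.
have eqq : (fun h : R => h^-1 *: (((fun t : R => g (t *: v + y)) \o shift s) (h *: 1)
     - g (s *: v + y)))
  = (fun h : R => h^-1 *: ((g \o shift (s *: v + y)) (h *: v) - g (s *: v + y))).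
  by apply/funext => h /=; rewrite addrA -scalerDl [h%:A]mulr1.
by apply: DeriveDef; rewrite /derivable /derive eqq.
Qed.

(** Pairing with a fixed [w] reduces to a scalar function on a line. The point [s] depends on [w];
    its location is not recorded, as the Hessian bounds hold everywhere. *)
Lemma dotp_grad_MVT g y v w : (forall z, differentiable (grad g) z) ->
  exists s : R, dotp w (grad g (v + y) - grad g y) =
                dotp w (hess g (s *: v + y) *m v).
Proof.
move=> dg; pose phi := fun z => dotp w (grad g z).
have dphi z : is_derive z v phi (dotp w (hess g z *m v)).
  have -> : phi = \sum_(i < d) (w i 0 *: (fun z => grad g z i 0)).
    apply/funext => t; rewrite /phi dotpE fct_sumE.
    by apply: eq_bigr => i _.
  have hi i : derivable (fun z => grad g z i 0) z v.
    apply: diff_derivable.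
    exact: (differentiable_comp (dg z) (differentiable_coord _ i 0)).
  rewrite dotpE; apply: is_derive_sum => i.
  apply: is_derive_eq; first exact: is_deriveZ (derivableP (hi i)).
  by rewrite hess_mulmxE.
have dl s : is_derive s (1 : R) (fun t : R => phi (t *: v + y))
    (dotp w (hess g (s *: v + y) *m v)).
  have := dphi (s *: v + y) => h.
  by have := is_derive_line (@ex_derive _ _ _ _ _ _ _ h); rewrite derive_val.
have [|s _] := @MVT R (fun t : R => phi (t *: v + y)) _ 0 1 ltr01 (fun s _ => dl s).
  by apply: derivable_within_continuous => s _; have [] := dl s.
rewrite /phi scale1r scale0r add0r subr0 mulr1 -dotpBr => e.
by exists s.
Qed.

Lemma grad_cocoercive g (m M : R) y z : m <= M ->
    (forall t, differentiable (grad g) t) ->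
    (forall t, loewner_le m%:M (hess g t) /\ loewner_le (hess g t) M%:M) ->
  dotp (grad g z - grad g y) (grad g z - grad g y) + m * M * dotp (z - y) (z - y)
    <= (m + M) * dotp (grad g z - grad g y) (z - y).
Proof.
move=> mM dg hg; set G := _ - grad g y; set D := z - y.
set c := (m + M) / 2; set r := (M - m) / 2.
set P := G - c *: D.
(* Expanding the square recovers the claim, since [2 c = m + M] and [c^2 - r^2 = m M]. *)
suff : dotp P P <= r ^+ 2 * dotp D D.
  rewrite /P dotpBsq !(dotpZl, dotpZr) /c /r; lra.
have [s] := dotp_grad_MVT y D P dg.
rewrite {1}/D subrK -/G; set H := hess g _ => PG.
have {PG} PP : dotp P P = dotp P ((H - c%:M) *m D).
  by rewrite mulmxBl mul_scalar_mx [RHS]dotpBr -PG -dotpBr.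
have [h1 h2] := hg (s *: D + y).
have symB : (H - c%:M)^T = H - c%:M.
  by have [+ _] := h2; rewrite -/H !linearB /= !tr_scalar_mx => /addrI/oppr_inj ->.
have hB u := loewner_centered u h1 h2.
(* If [m = M], no division by [r] is possible, but polarization gives [|P|^2 <= 0] at once. *)
have [r0|r0] := eqVneq r 0.
  have := dotp_mulmx_le P D symB hB.
  by rewrite -PP -/r r0 mul0r expr2 !mul0r pmulr_rle0 // ltr0n.
have rgt0 : 0 < r by rewrite lt_def r0 /r divr_ge0 // ?subr_ge0.
(* Scaling [D] by [r] balances the squares: [2 r |P|^2 <= r (|P|^2 + r^2 |D|^2)]. *)
have := dotp_mulmx_le P (r *: D) symB hB; rewrite -scalemxAr !(dotpZl, dotpZr) -PP -/r.
rewrite mulrCA ler_pM2l //; lra.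
Qed.

End Gradient.

(** * Spectral gap by unitary diagonalization *)

Section SpectralGap.
Variable R : realType.
Local Open Scope complex_scope.
Local Open Scope sesquilinear_scope.

(** In eigencoordinates both sides are sums of [|v_i|^2], weighted by [lam * b] and [b^2], so the
    hypothesis applies termwise. *)
Lemma spectral_gap (d : nat) (A : 'M[R]_d) (lam : R) (u : 'cV[R]_d) : A^T = A ->
    (forall b, eigenvalue A b -> lam * b <= b ^+ 2) ->
  lam * dotp u (A *m u) <= dotp (A *m u) (A *m u).
Proof.
move=> symA hA; pose toC := map_mx (real_complex R).
pose AC : 'M[R[i]]_d := toC _ _ A.
have conj_toC k l (B : 'M[R]_(k, l)) : (toC _ _ B)^t* = (toC _ _ B)^T.
  by apply/matrixP => i j; rewrite !mxE; apply/CrealP; rewrite complex_real.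
have hermA : AC \is hermsymmx.
  by apply/is_hermitianmxP; rewrite expr0 scale1r conj_toC /AC /toC map_trmx symA.
have realD := hermitian_spectral_diag_real hermA.
have /hermitian_normalmx/orthomx_spectralP := hermA.
set P := spectralmx AC; set D := spectral_diag AC => defA.
have unitP : P \is unitarymx by exact: spectral_unitarymx.
(* Row [i] of the invertible [P] is an eigenvector for [D 0 i]; this value is real, hence an
   eigenvalue of [A] itself. *)
have hD i : (lam%:C * D 0 i <= D 0 i ^+ 2).
  have /complex_realP [b Db] : D 0 i \is Num.real by apply/mxOverP.
  have : eigenvalue AC (D 0 i).
    apply/eigenvalueP; exists (row i P).
      rewrite {1}defA -row_mul !mulmxA mulmxV ?unitarymx_unit // mul1mx.
      by rewrite row_mul row_diag_mx -scalemxAl -rowE.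
    apply/eqP => Pi0; have := congr1 (fun z => row i z) (mulmxV (unitarymx_unit unitP)).
    rewrite row_mul Pi0 mul0mx row1 => /rowP/(_ i); rewrite !mxE !eqxx => /esym/eqP.
    by rewrite oner_eq0.
  by rewrite Db eigenvalue_map => /hA; rewrite -rmorphM -rmorphXn lecR.
have isoP k (x y : 'M[R[i]]_(d, k)) : x^t* *m y = (P *m x)^t* *m (P *m y).
  rewrite trmx_mul map_mxM mulmxA -(mulmxA _ _ P) -(invmx_unitary unitP).
  by rewrite mulVmx ?unitarymx_unit // mulmx1.
have dotp_toC x y : (dotp x y)%:C = ((P *m toC _ _ x)^t* *m (P *m toC _ _ y)) 0 0.
  by rewrite -isoP conj_toC map_trmx -map_mxM mxE.
have PA : P *m toC _ _ (A *m u) = diag_mx D *m (P *m toC _ _ u).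
  rewrite /toC map_mxM -/(toC _ _ A) -/AC {1}defA !mulmxA.
  by rewrite mulmxV ?unitarymx_unit // mul1mx.
rewrite -lecR rmorphM /= !dotp_toC !PA; move: (P *m _) => v.
rewrite !mul_diag_mx [in leLHS]mxE [in leRHS]mxE mulr_sumr; apply: ler_sum => i _.
rewrite !mxE rmorphM /=.
have /CrealP -> : D 0 i \is Num.real by apply/mxOverP.
rewrite [leLHS](_ : _ = (lam%:C * D 0 i) * (v i 0 * Num.conj (v i 0))); last by ring.
rewrite [leRHS](_ : _ = D 0 i ^+ 2 * (v i 0 * Num.conj (v i 0))); last by ring.
by apply: ler_wpM2r (hD i); exact: mul_conjC_ge0.
Qed.

End SpectralGap.

(** * Nodewise decomposition of the aggregate objective *)

Section Aggregate.
Variables (R : realType) (n p : nat).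
Implicit Types (f : 'I_n -> 'cV[R]_p -> R) (x y : 'cV[R]_(n * p)).

Lemma blockB x y i : block (x - y) i = block x i - block y i.
Proof. by apply/colP => k; rewrite !mxE. Qed.

Lemma blockD x y i : block (x + y) i = block x i + block y i.
Proof. by apply/colP => k; rewrite !mxE. Qed.

Lemma blockZ a x i : block (a *: x) i = a *: block x i.
Proof. by apply/colP => k; rewrite !mxE. Qed.

Lemma dotp_block x y : dotp x y = \sum_i dotp (block x i) (block y i).
Proof.
rewrite dotpE; under [RHS]eq_bigr do rewrite dotpE.
rewrite pair_bigA /= (reindex (@mxtens_index n p)) /=; last first.
  by exists (@mxtens_unindex n p) => k _; rewrite (mxtens_indexK, mxtens_unindexK).
by apply: eq_bigr => -[i k] _; rewrite !mxE.
Qed.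

Lemma block_delta j i k : block (delta_mx (mxtens_index (j, k)) 0 : 'cV[R]_(n * p)) i =
  (if i == j then delta_mx k 0 else 0) :> 'cV[R]_p.
Proof.
apply/colP => l; rewrite !mxE.
rewrite (inj_eq (can_inj (@mxtens_indexK n p))) xpair_eqE andbT.
by case: eqP => _; rewrite !mxE ?eqxx ?andbT.
Qed.

Lemma is_derive_block (h : 'cV[R]_p -> R) x (v : 'cV[R]_(n * p)) i :
  derivable h (block x i) (block v i) ->
  is_derive x v (fun y => h (block y i)) ('D_(block v i) h (block x i)).
Proof.
move=> dh.
have eqq : (fun t : R => t^-1 *: (((fun y => h (block y i)) \o shift x) (t *: v)
     - h (block x i)))
  = (fun t : R => t^-1 *: ((h \o shift (block x i)) (t *: block v i) - h (block x i))).
  by apply/funext => t /=; rewrite blockD blockZ.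
by apply: DeriveDef; rewrite /derivable /derive eqq.
Qed.

Lemma is_derive_aggregate f x (v : 'cV[R]_(n * p)) :
    (forall i z, differentiable (f i) z) ->
  is_derive x v (aggregate f) (\sum_i 'D_(block v i) (f i) (block x i)).
Proof.
move=> df; have -> : aggregate f = \sum_i (fun y => f i (block y i)).
  by apply/funext => y; rewrite fct_sumE.
by apply: is_derive_sum => i; apply/is_derive_block/diff_derivable.
Qed.

(** A basis direction moves the copy of a single node, so only one summand contributes. *)
Lemma block_grad f x i : (forall i z, differentiable (f i) z) ->
  block (grad (aggregate f) x) i = grad (f i) (block x i).
Proof.
move=> df; apply/colP => k; rewrite !mxE.
rewrite (@derive_val _ _ _ _ _ _ _ (is_derive_aggregate x _ df)).
rewrite (bigD1 i) //= big1 ?addr0 => [|j ji]; first by rewrite block_delta eqxx.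
by rewrite block_delta (negPf ji) derive0.
Qed.

Lemma grad_aggregate_cocoercive f (m M : R) x y : m <= M ->
    (forall i, twice_differentiable (f i)) ->
    (forall i t,
       loewner_le m%:M (hess (f i) t) /\ loewner_le (hess (f i) t) M%:M) ->
  dotp (grad (aggregate f) y - grad (aggregate f) x)
       (grad (aggregate f) y - grad (aggregate f) x) + m * M * dotp (y - x) (y - x)
    <= (m + M) * dotp (grad (aggregate f) y - grad (aggregate f) x) (y - x).
Proof.
move=> mM df hf; set G := _ - grad _ x.
have blockG i : block G i = grad (f i) (block y i) - grad (f i) (block x i).
  by rewrite blockB !block_grad // => j z; have [] := df j.
rewrite !dotp_block !mulr_sumr -big_split /=; apply: ler_sum => i _.
rewrite blockG blockB; apply: grad_cocoercive => //.
by have [] := df i.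
Qed.

End Aggregate.

(** * First-order optimality of the proximal step *)

Section Optimality.
Variables (R : realType) (d : nat).
Implicit Types (F : 'cV[R]_d -> R) (A S : 'M[R]_d) (x y v b : 'cV[R]_d).

(** On each coordinate line through [x], the function [F] plus a linear and a quadratic term is
    minimal at [x], where the quadratic term has zero slope. *)
Lemma grad_min_quadratic F A b x : (forall y i, derivable F y (delta_mx i 0)) ->
    (forall y, 0 <= F y - F x + dotp b (y - x) + qform A (y - x)) ->
  grad F x + b = 0.
Proof.
move=> dF hmin; apply/colP => i; rewrite !mxE; set e := delta_mx i 0.
pose psi (t : R) := F (t *: e + x) + (t * b i 0 + t ^+ 2 * qform A e).
have dl t : is_derive t (1 : R) (fun t : R => F (t *: e + x)) ('D_e F (t *: e + x)).
  by apply: is_derive_line; exact: dF.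
have dpsi t : is_derive t (1 : R) psi
   ('D_e F (t *: e + x) + (b i 0 + 2 * t * qform A e)).
  have -> : psi = (fun t => F (t *: e + x)) + (b i 0 *: id + qform A e *: (id : R -> R) ^+ 2).
    apply/funext => s; rewrite /psi -!/(_ + _) /= !fctE /= expr2.
    by rewrite -[b i 0 *: s]/(b i 0 * s) -[qform A e *: _]/(qform A e * _); ring.
  apply: is_deriveD.
  apply: is_derive_eq.
  rewrite -![_ *: _]/(_ * _) /=; ring.
have psi0 : is_derive (0 : R) (1 : R) psi 0.
  apply: (@derive1_at_min _ psi (-1) 1).
  - by lra.
  - by move=> t _; have [] := dpsi t.
  - by rewrite in_itv /=; lra.
  move=> t _; have := hmin (t *: e + x).
  rewrite addrK !qformE -scalemxAr !(dotpZr, dotpZl) dotp_delta /psi scale0r add0r !qformE.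
  rewrite mul0r expr0n mul0r !addr0 => h; rewrite -subr_ge0; apply: le_trans h _.
  by rewrite le_eqVlt; apply/orP; left; apply/eqP; ring.
have := @derive_val _ _ _ _ _ _ _ (dpsi 0); rewrite derive_val scale0r add0r.
by rewrite mulr0 mul0r addr0.
Qed.

Lemma proximal_step_stationary F S A (alpha eps : R) x v y :
    A^T = A -> S^T = S -> (forall y i, derivable F y (delta_mx i 0)) ->
    is_minimizer (fun=> True)
      (fun z => aug_lagrangian F S A alpha z v + eps / 2 * qform 1%:M (z - x)) y ->
  grad F y + (S *m v + alpha *: (A *m y) + eps *: (y - x)) = 0.
Proof.
move=> symA symS dF [_ hy].
(* Apart from [F] the objective is quadratic, so its second-order expansion at [y] is exact. *)
apply: (@grad_min_quadratic F (alpha / 2 *: A + (eps / 2)%:M)) => // z.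
have := hy z I; rewrite -subr_ge0 => h; apply: le_trans h _.
rewrite le_eqVlt; apply/orP; left; apply/eqP.
have -> : z = (z - y) + y by rewrite subrK.
move: (z - y) => w; rewrite addrK /aug_lagrangian.
have -> : w + y - x = w + (y - x) by rewrite addrA.
rewrite !qformE !mul1mx !mulmxDl mul_scalar_mx !mulmxDr -scalemxAl.
rewrite !(dotpDl, dotpDr, dotpZl, dotpZr).
rewrite !(dotp_mulmx_sym _ _ symS) -!(dotp_mulmx_sym y w symA).
by rewrite (dotpC w y) (dotpC w (- x)) (dotpC y (- x)) (dotpC w (A *m y)); field.
Qed.

End Optimality.

(** * The G-norm and the spectrum of the constraint matrix *)

Lemma qform_Gmx (R : realType) (d : nat) (alpha eps : R) (a b a' b' : 'cV[R]_d) :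
  qform (Gmx d alpha eps) (col_mx a b - col_mx a' b') =
  dotp (a - a') (a - a') + alpha * eps * dotp (b - b') (b - b').
Proof.
rewrite qformE /Gmx opp_col_mx add_col_mx mul_block_col !mul0mx mul1mx mul_scalar_mx.
by rewrite addr0 add0r {1}/dotp tr_col_mx mul_row_col mxE -!/(dotp _ _) dotpZr.
Qed.

(** Eigenvectors are rows here; symmetry of [A] turns [z] into a column eigenvector. *)
Lemma psd_eigenvalue_ge0 (R : realType) (d : nat) (A : 'M[R]_d) (b : R) :
  psd A -> eigenvalue A b -> 0 <= b.
Proof.
move=> [symA posA] /eigenvalueP [z zA z0].
have h := posA z^T; rewrite qformE in h.
have Az : A *m z^T = b *: z^T by rewrite -{1}symA -trmx_mul zA linearZ.
rewrite Az dotpZr in h; rewrite leNgt; apply/negP => b0.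
have : z^T = 0 by apply: dotp_eq0; rewrite -(nmulr_rge0 _ b0).
by move=> /(congr1 trmx); rewrite trmxK trmx0 => /eqP; rewrite (negPf z0).
Qed.

Lemma psd_of_sqrt (R : realType) (d : nat) (S A : 'M[R]_d) : is_psd_sqrt S A -> psd A.
Proof.
move=> [[symS _] <-]; split=> [|u]; first by rewrite trmx_mul symS.
by rewrite qformE -mulmxA -dotp_mulmx_sym // dotp_ge0.
Qed.

(** With [S^2 = A] the sides become [lam <w, A w>] and [|A w|^2]. The eigenvalue zero gives
    equality; every other one is at least [lam]. *)
Lemma sqrt_spectral_gap (R : realType) (d : nat) (S A : 'M[R]_d) (lam : R)
    (w : 'cV[R]_d) :
    is_psd_sqrt S A -> is_min_nonzero_eigenvalue A lam ->
  lam * dotp (S *m w) (S *m w) <= dotp (S *m (S *m w)) (S *m (S *m w)).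
Proof.
move=> hS; have [[symS _] SS] := hS; move=> [_ _ min_lam].
have psdA : psd A by exact: (psd_of_sqrt hS).
rewrite (dotp_mulmx_sym w _ symS) !mulmxA SS; apply: spectral_gap psdA.1 _ => b eig_b.
have [->|b0] := eqVneq b 0; first by rewrite mulr0 expr0n.
rewrite expr2 ler_wpM2r ?min_lam //; exact: psd_eigenvalue_ge0 eig_b.
Qed.

Lemma is_min_nonzero_eigenvalue_gt0 (R : realType) (d : nat) (A : 'M[R]_d) (lam : R) :
  psd A -> is_min_nonzero_eigenvalue A lam -> 0 < lam.
Proof. by move=> psdA [e l0 _]; rewrite lt_def l0 (psd_eigenvalue_ge0 psdA e). Qed.

(** Here [gg], [sx], [sv], [dv], [dx] stand for squared norms, [gx] for [<g, dx>] and [E] for the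
    previous squared G-norm. It suffices that [delta] times the new error is at most the
    decrease. *)
Lemma pmm_contraction_scalar (R : realType)
    (alpha eps beta m M lam gg sx sv gx dv dx E delta : R) :
    0 < alpha -> 0 < eps -> 1 < beta -> 0 < m -> m <= M -> 0 < lam ->
    0 <= gg -> 0 <= sx -> 0 <= sv -> 0 <= dx ->
    gg + m * M * dx <= (m + M) * gx ->
    lam * dv <= beta * gg + beta / (beta - 1) * eps ^+ 2 * sx ->
    E = dv + alpha * eps * dx + 2 * alpha * gx + sv + alpha * eps * sx ->
    delta =
    Num.min (2 * alpha * lam / (beta * (m + M)))
      (Num.min (2 * m * M / (eps * (m + M)))
               ((beta - 1) * alpha * lam / (beta * eps))) ->
  dv + alpha * eps * dx <= 1 / (1 + delta) * E.
Proof.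
move=> a0 e0 b1 m0 mM l0 gg0 sx0 sv0 dx0 coco young -> def_delta.
have mM0 : 0 < m + M by lra.
have M0 : 0 < M by lra.
have b0 : 0 < beta by lra.
have b10 : 0 < beta - 1 by lra.
have delta0 : 0 < delta by rewrite def_delta !lt_min !divr_gt0 ?mulr_gt0.
have : delta <= delta by [].
rewrite {2}def_delta !le_min => /and3P[].
rewrite !ler_pdivlMr ?mulr_gt0 // => d1 d2 d3.
rewrite mul1r ler_pdivlMl ?addr_gt0 //.
(* The second term of the minimum controls the primal error. *)
have hx : (m + M) * (delta * (alpha * eps * dx)) <= 2 * alpha * (m * M * dx).
  by have := ler_wpM2r (mulr_ge0 (ltW a0) dx0) d2; lra.
(* The first and third terms absorb the [gg] and [sx] parts of Young's bound. *)
have hv : (m + M) * (delta * dv) <= 2 * alpha * gg + (m + M) * (alpha * eps * sx).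
  rewrite -(ler_pM2l (mulr_gt0 l0 b10)).
  have {}young : (beta - 1) * (lam * dv) <= (beta - 1) * (beta * gg) + beta * eps ^+ 2 * sx.
    have := ler_wpM2l (ltW b10) young.
    suff -> : (beta - 1) * (beta * gg + beta / (beta - 1) * eps ^+ 2 * sx) =
              (beta - 1) * (beta * gg) + beta * eps ^+ 2 * sx by [].
    by field; rewrite gt_eqF.
  have hd1 := ler_wpM2r (mulr_ge0 (ltW b10) gg0) d1.
  have hd3 := ler_wpM2r (mulr_ge0 (mulr_ge0 (ltW e0) sx0) (ltW mM0)) d3.
  have hy := ler_wpM2l (mulr_ge0 (ltW delta0) (ltW mM0)) young.
  rewrite expr2 in hy; lra.
have hc := ler_wpM2l (ltW a0) coco.
suff : (m + M) * (delta * (dv + alpha * eps * dx)) <=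
       (m + M) * (2 * alpha * gx + alpha * eps * sx).
  by rewrite ler_pM2l // => h; lra.
lra.
Qed.

(** * Contraction of the PMM iterates *)

Theorem theorem1 (R : realType) (n p : nat)
    (N : 'I_n -> {set 'I_n}) (W : 'M[R]_n) (f : 'I_n -> 'cV[R]_p -> R)
    (S : 'M[R]_(n * p)) (alpha eps beta m M lam_min : R)
    (x v : nat -> 'cV[R]_(n * p)) (xstar vstar : 'cV[R]_(n * p))
    (hN : connected_network N)
    (hW : weight_matrix N W)
    (hS : is_psd_sqrt S (1%:M - kron_weight p W))
    (halpha : 0 < alpha) (heps : 0 < eps) (hbeta : 1 < beta)
    (hlam : is_min_nonzero_eigenvalue (1%:M - kron_weight p W) lam_min)
    (hm : 0 < m) (hmM : m <= M)
    (hf2 : forall i, twice_differentiable (f i))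
    (hfmM : forall i y,
       loewner_le m%:M (hess (f i) y) /\ loewner_le (hess (f i) y) M%:M)
    (hxstar : primal_solution (aggregate f) S xstar)
    (hvstar : kkt_multiplier (aggregate f) S xstar vstar)
    (* the dual optimum is only unique modulo the kernel of S: vstar is the one
       whose offset from the initial multiplier lies in the range of S *)
    (hv0 : exists w : 'cV[R]_(n * p), v 0%N - vstar = S *m w)
    (hxv : pmm_iterates (aggregate f) S (1%:M - kron_weight p W)
             alpha eps x v) :
  let G := Gmx (n * p) alpha eps in
  let u := fun t : nat => col_mx (v t) (x t) in
  let ustar := col_mx vstar xstar in
  let delta :=
    Num.min (2 * alpha * lam_min / (beta * (m + M)))
      (Num.min (2 * m * M / (eps * (m + M)))
               ((beta - 1) * alpha * lam_min / (beta * eps))) in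
  forall t : nat,
    qform G (u t.+1 - ustar) <= 1 / (1 + delta) * qform G (u t - ustar).
Proof.
move=> G u ustar delta t; rewrite /G /u /ustar !qform_Gmx.
have [[symS _] SS] := hS; set A := 1%:M - kron_weight p W in hS SS hlam hxv.
have psdA := psd_of_sqrt hS.
have lam0 := is_min_nonzero_eigenvalue_gt0 psdA hlam.
have [Sxs _] := hxstar.
have df i z : differentiable (f i) z by have [] := hf2 i.
have dF z i : derivable (aggregate f) z (delta_mx i 0).
  by have [] := is_derive_aggregate z (delta_mx i 0) df.
(* Each dual update adds a vector in the range of [S], so the initial property persists. *)
have range_v k : exists w, v k - vstar = S *m w.
  elim: k => [//|k [w hw]]; exists (w + alpha *: x k.+1).
  by rewrite (hxv k).2 addrAC hw mulmxDr -scalemxAr.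
have [hmin hv] := hxv t.
have := proximal_step_stationary psdA.1 symS dF hmin.
set F := aggregate f in hvstar *; set g := grad F (x t.+1) - grad F xstar.
set dx := x t.+1 - xstar; set dv := v t.+1 - vstar.
set sx := x t.+1 - x t; set sv := v t.+1 - v t.
have Sdx : alpha *: (S *m dx) = sv.
  by rewrite /dx mulmxBr Sxs subr0 /sv hv addrC addKr.
move=> stat.
(* Subtract the KKT condition and absorb [alpha A x_{t+1}] into [S v_{t+1}]. *)
have {stat} key : g + eps *: sx = - (S *m dv).
  apply/eqP; rewrite -addr_eq0; apply/eqP.
  rewrite -[RHS](subrr (0 : 'cV[R]_(n * p))) -{1}stat -hvstar /g /dv hv mulmxBr mulmxDr.
  rewrite -scalemxAr mulmxA SS -/sx.
  by apply/colP => i; rewrite !mxE; ring.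
have gap : lam_min * dotp dv dv <= dotp (g + eps *: sx) (g + eps *: sx).
  have [w hw] := range_v t.+1.
  rewrite key -[dv]/(v t.+1 - vstar) hw -scaleN1r dotpZl dotpZr mulN1r mulN1r opprK.
  exact: sqrt_spectral_gap hS hlam.
have young := dotpD_young g (eps *: sx) hbeta.
have coco : dotp g g + m * M * dotp dx dx <= (m + M) * dotp g dx.
  exact: grad_aggregate_cocoercive.
(* Pair [key] with [dx], move [S] across and use [alpha S dx = sv]. *)
have inner : alpha * dotp g dx + alpha * eps * dotp sx dx + dotp dv sv = 0.
  have : dotp (g + eps *: sx) dx = - dotp dv (S *m dx).
    by rewrite key -dotp_mulmx_sym // -scaleN1r dotpZl mulN1r.
  rewrite dotpDl dotpZl -Sdx => e; rewrite [dotp dv (alpha *: _)]dotpZr.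
  rewrite -mulrA -!mulrDr e addNr mulr0 //.
have prev_v : v t - vstar = dv - sv by apply/colP => i; rewrite !mxE; ring.
have prev_x : x t - xstar = dx - sx by apply/colP => i; rewrite !mxE; ring.
rewrite prev_v prev_x (dotpBsq dv) (dotpBsq dx) (dotpC dx).
set a := dotp g dx in coco inner *.

apply: (pmm_contraction_scalar halpha heps hbeta hm hmM lam0 (dotp_ge0 g)
  (dotp_ge0 sx) (dotp_ge0 sv) (dotp_ge0 dx) coco _ _ (erefl delta)).
  apply: le_trans gap _.
  by move: young; rewrite !(dotpZl, dotpZr) expr2 !mulrA.
(* Adding twice [inner] trades the cross terms of the expanded squares for [2 alpha <g, dx>]. *)
rewrite -[LHS]addr0 -(mulr0 2) -inner; ring.
Qed.
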